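(* Let $\Omega$ be an eventually outward finitely branched tree quiver and $V$ a representation of $\Omega$ over a field. Then the sum of the subrepresentations $F^\alpha$, $\alpha\in\mathcal{C}$, spans $V$, i.e. $\sum_{\alpha\in\mathcal{C}}F^\alpha=V$.
   Context: A quiver $\Omega$ consists of a set $\Omega_0$ of vertices, a set $\Omega_1$ of arrows, and source and target functions $s,t:\Omega_1\to\Omega_0$. It is a tree if its underlying undirected graph is a tree (at most one arrow between two vertices, no loops). A walk is a map $w$ from a finite or infinite interval of $\mathbb{Z}$ to $\Omega_0$ with consecutive values joined by an arrow $e$; $e$ is oriented consistently if $s(e)=w_i,\ t(e)=w_{i+1}$, inconsistently if $s(e)=w_{i+1},\ t(e)=w_i$. A journey is a walk whose interval has a minimal element. $\Omega$ is finitely branched if it is a union of finitely many injective walks, and eventually outward if every injective journey contains at most finitely many arrows oriented inconsistently. Removing an arrow $e$ splits $\Omega$ into two connected subquivers: the one containing $t(e)$ is in front of $e$, and the one containing $s(e)$ is behind $e$. Anything contained in the former (latter) is in front of (behind) $e$, and $e$ points towards (away from) it. $\mathcal{C}$ is the set of (nonempty) connected full subquivers of $\Omega$. A boundary arrow of $\alpha\in\mathcal{C}$ is an arrow with exactly one endpoint in $\alpha$; $\mathrm{iba}(\alpha)$ (resp. $\mathrm{oba}(\alpha)$) is the set of those pointing towards (resp. away from) $\alpha$. A representation $V$ consists of vector spaces $V_i$ ($i\in\Omega_0$) and linear maps $f_e:V_{s(e)}\to V_{t(e)}$ ($e\in\Omega_1$). The transport of a subspace of $V_i$ to a vertex $j$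 follows the unique injective walk from $i$ to $j$, taking the image under $f_e$ when $e$ is crossed from $s(e)$ to $t(e)$ and the preimage under $f_e$ when $e$ is crossed from $t(e)$ to $s(e)$. For an arrow $e$: $V^{e,+}_i=V_i$ if $i$ is behind $e$, and otherwise the transport of $V_{t(e)}$ from $t(e)$ to $i$; $V^{e,-}_i=0$ if $i$ is in front of $e$, and otherwise the transport of $\{0\}\subseteq V_{t(e)}$ to $i$. These are subrepresentations of $V$. A virtual arrow $E$ is an injective journey with all arrows oriented away from its start, which is either infinite or ends in a leaf of $\Omega$ (possibly a single leaf vertex). $V^{E,+}_i=V_i$ if $i\in E$, and otherwise the transport to $i$ of $V_j$, with $j$ the vertex of $E$ closest to $i$. If $E$ lies entirely in $\alpha$ it is a virtual boundary arrow of $\alpha$. For $\alpha\in\mathcal{C}$, $F^\alpha$ is the intersection of all $V^{e,+}$ for $e\in\mathrm{iba}(\alpha)$, all $V^{e,-}$ for $e\in\mathrm{oba}(\alpha)$, and all $V^{E,+}$ for $E$ a virtual boundary arrow of $\alpha$. *)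

(* Defs.v *)
From HB Require Import structures.
From mathcomp Require Import all_boot all_order all_algebra.
From Stdlib Require List.
From mathcomp Require Import boolp classical_sets cardinality.

Set Implicit Arguments.
Unset Strict Implicit.
Unset Printing Implicit Defensive.

Import Order.TTheory GRing.Theory Num.Theory.

Local Open Scope classical_set_scope.
Local Open Scope ring_scope.

Record quiver := Quiver {
  vertex : Type;
  arrow : Type;
  src : arrow -> vertex;
  tgt : arrow -> vertex }.

Section QuiverCombinatorics.
Variable Q : quiver.
Local Notation vertex := (vertex Q).
Local Notation arrow := (arrow Q).

Definition joins (e : arrow) (x y : vertex) : Prop :=
  (src e = x /\ tgt e = y) \/ (src e = y /\ tgt e = x).

Definition adjacent (x y : vertex) : Prop := exists e, joins e x y.

(* A walk is a map from an interval of Z; the values of [wpos] outside [wdom]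
   are irrelevant. *)
Record walk := Walk {
  wdom : set int;
  wpos : int -> vertex;
  wdom_interval : forall a b c : int,
    wdom a -> wdom c -> a <= b -> b <= c -> wdom b;
  wpos_adjacent : forall n : int,
    wdom n -> wdom (n + 1) -> adjacent (wpos n) (wpos (n + 1)) }.

Definition walk_injective (w : walk) : Prop :=
  forall m n : int, wdom w m -> wdom w n -> wpos w m = wpos w n -> m = n.

Definition journey (w : walk) : Prop :=
  exists a : int, wdom w a /\ forall n : int, wdom w n -> a <= n.

Definition walk_vertices (w : walk) : set vertex :=
  [set x | exists n : int, wdom w n /\ wpos w n = x].

Definition walk_arrows (w : walk) : set arrow :=
  [set e | exists n : int,
    [/\ wdom w n, wdom w (n + 1) & joins e (wpos w n) (wpos w (n + 1))]].

Definition consistent_arrows (w : walk) : set arrow :=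
  [set e | exists n : int,
    [/\ wdom w n, wdom w (n + 1), src e = wpos w n & tgt e = wpos w (n + 1)]].

Definition inconsistent_arrows (w : walk) : set arrow :=
  [set e | exists n : int,
    [/\ wdom w n, wdom w (n + 1), src e = wpos w (n + 1) & tgt e = wpos w n]].

Definition finitely_branched : Prop :=
  exists (n : nat) (w : 'I_n -> walk),
    [/\ forall k, walk_injective (w k),
        \bigcup_k walk_vertices (w k) = setT
      & \bigcup_k walk_arrows (w k) = setT].

Definition eventually_outward : Prop :=
  forall w : walk, journey w -> walk_injective w ->
    finite_set (inconsistent_arrows w).

(* A finite walk from the first to the second index, recording the arrows
   crossed.  The indices make transport along it typecheck without casts. *)
Inductive fwalk : vertex -> vertex -> Type :=
| Stay (i : vertex) : fwalk i i
| Forward (e : arrow) (j : vertex) : fwalk (tgt e) j -> fwalk (src e) j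
| Backward (e : arrow) (j : vertex) : fwalk (src e) j -> fwalk (tgt e) j.

Fixpoint fwalk_vertices (i j : vertex) (p : fwalk i j) : seq vertex :=
  match p with
  | Stay i => [:: i]
  | Forward e _ q => src e :: fwalk_vertices q
  | Backward e _ q => tgt e :: fwalk_vertices q
  end.

Fixpoint fwalk_arrows (i j : vertex) (p : fwalk i j) : seq arrow :=
  match p with
  | Stay _ => [::]
  | Forward e _ q => e :: fwalk_arrows q
  | Backward e _ q => e :: fwalk_arrows q
  end.

Definition fwalk_length (i j : vertex) (p : fwalk i j) : nat :=
  size (fwalk_arrows p).

Definition fwalk_injective (i j : vertex) (p : fwalk i j) : Prop :=
  List.NoDup (fwalk_vertices p).

(* A full subquiver is given by its set of vertices; the empty one is excluded. *)
Definition connected : set (set vertex) := fun a =>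
  a !=set0 /\
  forall i j, a i -> a j ->
    exists p : fwalk i j, forall x, List.In x (fwalk_vertices p) -> a x.

Definition tree : Prop :=
  [/\ forall e : arrow, src e <> tgt e,
      forall (e e' : arrow) x y, joins e x y -> joins e' x y -> e = e',
      connected setT
    & forall i j (p : fwalk i j), fwalk_injective p ->
        (3 <= size (fwalk_vertices p))%N -> ~ adjacent j i].

Definition leaf (i : vertex) : Prop :=
  exists! e : arrow, src e = i \/ tgt e = i.

Definition in_front (e : arrow) : set vertex :=
  [set i | exists p : fwalk (tgt e) i, ~ List.In e (fwalk_arrows p)].

Definition behind (e : arrow) : set vertex :=
  [set i | exists p : fwalk (src e) i, ~ List.In e (fwalk_arrows p)].

Definition boundary_arrow (a : set vertex) (e : arrow) : Prop :=
  (a (src e) /\ ~ a (tgt e)) \/ (~ a (src e) /\ a (tgt e)).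

Definition iba (a : set vertex) : set arrow :=
  [set e | boundary_arrow a e /\ a `<=` in_front e].

Definition oba (a : set vertex) : set arrow :=
  [set e | boundary_arrow a e /\ a `<=` behind e].

Definition virtual_arrow (E : walk) : Prop :=
  [/\ journey E,
      walk_injective E,
      walk_arrows E `<=` consistent_arrows E
    & infinite_set (wdom E) \/
      exists b : int, [/\ wdom E b, forall n : int, wdom E n -> n <= b
                        & leaf (wpos E b)]].

Definition virtual_boundary_arrow (a : set vertex) (E : walk) : Prop :=
  virtual_arrow E /\ walk_vertices E `<=` a.

Definition closest (E : set vertex) (i j : vertex) : Prop :=
  E j /\ exists p : fwalk i j,
    forall j' (q : fwalk i j'), E j' -> (fwalk_length p <= fwalk_length q)%N.

End QuiverCombinatorics.

Record representation (k : fieldType) (Q : quiver) := Representation {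
  space :> vertex Q -> lmodType k;
  rmap : forall e : arrow Q, {linear space (src e) -> space (tgt e)} }.

Section Filtrations.
Variables (k : fieldType) (Q : quiver) (V : representation k Q).

Fixpoint transport_along (i j : vertex Q) (p : fwalk i j) :
    set (V i) -> set (V j) :=
  match p in fwalk i j return set (V i) -> set (V j) with
  | Stay _ => fun U => U
  | Forward e _ q => fun U => transport_along q (rmap V e @` U)
  | Backward e _ q => fun U => transport_along q (rmap V e @^-1` U)
  end.

(* The transport is along "the" injective walk: in a tree there is exactly one injective [p] from [i] to [j]. *)
Definition transport (i j : vertex Q) (U : set (V i)) : set (V j) :=
  [set x | exists p : fwalk i j, fwalk_injective p /\ transport_along p U x].

Definition Vplus (e : arrow Q) (i : vertex Q) : set (V i) :=
  if `[< behind e i >] then setT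
  else @transport (tgt e) i setT.

Definition Vminus (e : arrow Q) (i : vertex Q) : set (V i) :=
  if `[< in_front e i >] then [set 0]
  else @transport (tgt e) i [set 0].

Definition Vvirtual (E : walk Q) (i : vertex Q) : set (V i) :=
  if `[< walk_vertices E i >] then setT
  else [set x | exists j, closest (walk_vertices E) i j /\
                          @transport j i setT x].

Definition Fsub (a : set (vertex Q)) (i : vertex Q) : set (V i) :=
  [set x | [/\ forall e, iba a e -> Vplus e x,
               forall e, oba a e -> Vminus e x
             & forall E, virtual_boundary_arrow a E -> Vvirtual E x]].

End Filtrations.

(* The sum of the subspaces [W a], for [a] in [P]: all finite sums of their
   elements. *)
Definition sum_of_subspaces (k : fieldType) (U : lmodType k) (J : Type)
    (P : set J) (W : J -> set U) : set U :=
  [set v | exists (n : nat) (a : 'I_n -> J) (x : 'I_n -> U),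
     (forall m, P (a m) /\ W (a m) (x m)) /\ v = \sum_(m < n) x m].

(* Main.v *)
Require Import Defs.
From mathcomp Require Import all_boot all_order all_algebra.
From mathcomp Require Import boolp classical_sets cardinality.

(** For each vertex [i] a single summand already fills [V i]: the one indexed
    by the set [descendants i] of all vertices that can be reached from [i] by
    following arrows from source to target.

    This set is connected, and no arrow leaves it, so in a tree every boundary
    arrow points towards it (lemma [tgt_not_behind] excludes the alternative)
    and the subspaces [Vminus] impose no condition.  The conditions from the
    incoming boundary arrows and from the virtual ones ask that a vector of
    [V i] lie in the transport to [i] of the whole space at some descendant [j]
    of [i].  The walk from [j] to [i] crosses every arrow from target to
    source, hence transport along it only takes preimages, and the preimage of
    a whole space is a whole space (lemma [transport_descendant]).

    The walk used for transport has to be injective, and loop erasure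
    (lemma [loop_erasure]) provides one; the same lemma, keeping track of the
    arrows used, serves to show that an arrow of a tree separates its ends. *)

Set Implicit Arguments.
Unset Strict Implicit.
Unset Printing Implicit Defensive.

Section Walks.
Variable Q : quiver.
Implicit Types (i j x : vertex Q) (e : arrow Q) (a : set (vertex Q)).

Fixpoint against_arrows i j (p : fwalk i j) : Prop :=
  match p with
  | Stay _ => True
  | Forward _ _ _ => False
  | Backward _ _ q => against_arrows q
  end.

Lemma fwalk_suffix i j (p : fwalk i j) x : List.In x (fwalk_vertices p) ->
  exists q : fwalk x j,
    [/\ fwalk_injective p -> fwalk_injective q,
        List.incl (fwalk_arrows q) (fwalk_arrows p)
      & against_arrows p -> against_arrows q].
Proof.
elim: p => [{}i|e {}j p IHp|e {}j p IHp] /=.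
- by case=> // <-; exists (Stay i); split=> // ? [].
- case=> [<-|/IHp[q [qinj qarr _]]].
    by exists (Forward p); split=> // ?.
  exists q; split=> //.
    by move=> pinj; apply: qinj; inversion pinj.
  by move=> f /qarr; right.
- case=> [<-|/IHp[q [qinj qarr qag]]].
    by exists (Backward p); split=> // ?.
  exists q; split=> //.
    by move=> pinj; apply: qinj; inversion pinj.
  by move=> f /qarr; right.
Qed.

(** If prepending a step to an injective walk makes its start occur twice,
    then the suffix from the later occurrence is the shortened walk. *)
Lemma loop_erasure i j (p : fwalk i j) :
  exists q : fwalk i j,
    [/\ fwalk_injective q,
        List.incl (fwalk_arrows q) (fwalk_arrows p)
      & against_arrows p -> against_arrows q].
Proof.
elim: p => [{}i|e {}j p [q [qinj qarr qag]]|e {}j p [q [qinj qarr qag]]] /=.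
- exists (Stay i); split=> //.
  by constructor; [case | constructor].
- have [/fwalk_suffix[r [rinj rarr _]]|snq] :=
    EM (List.In (src e) (fwalk_vertices q)).
    by exists r; split=> //; [exact: rinj | move=> f /rarr/qarr; right].
  exists (Forward q); split=> //; first exact: List.NoDup_cons.
  by move=> f /= [<-|/qarr]; [left|right].
- have [/fwalk_suffix[r [rinj rarr rag]]|snq] :=
    EM (List.In (tgt e) (fwalk_vertices q)).
    exists r; split=> //; first exact: rinj.
      by move=> f /rarr/qarr; right.
    by move=> /qag/rag.
  exists (Backward q); split=> //; first exact: List.NoDup_cons.
  by move=> f /= [<-|/qarr]; [left|right].
Qed.

Lemma size_fwalk_vertices i j (p : fwalk i j) :
  size (fwalk_vertices p) = (size (fwalk_arrows p)).+1.
Proof. by elim: p => //= e {}j p ->. Qed.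

Lemma fwalk_arrows_nil i j (p : fwalk i j) : fwalk_arrows p = [::] -> i = j.
Proof. by case: p. Qed.

Lemma fwalk_arrows_single i j (p : fwalk i j) e :
  fwalk_arrows p = [:: e] -> joins e i j.
Proof.
case: p => // f {}j p /= [<- /fwalk_arrows_nil <-]; first by left.
by right.
Qed.

(** Otherwise, after loop erasure, an injective walk between the ends of [e]
    that avoids [e] would be either a second arrow between these ends or the
    rest of a cycle through [e]. *)
Lemma tgt_not_behind e : tree Q -> ~ behind e (tgt e).
Proof.
move=> [noloop simple _ acyclic] [p pe].
have [q [qinj qarr _]] := loop_erasure p.
have qe : ~ List.In e (fwalk_arrows q) by move=> /qarr.
case qE: (fwalk_arrows q) => [|f [|g s]].
- by apply: (noloop e); exact: fwalk_arrows_nil qE.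
- have ef : e = f.
    by apply: simple (fwalk_arrows_single qE); left.
  by apply: qe; rewrite qE ef; left.
- apply: (acyclic _ _ q qinj); first by rewrite size_fwalk_vertices qE.
  by exists e; right.
Qed.

Definition linked a i j : Prop :=
  exists p : fwalk i j, forall x, List.In x (fwalk_vertices p) -> a x.

Lemma linked_trans a i j l : linked a i j -> linked a j l -> linked a i l.
Proof.
move=> [p]; elim: p => [|e {}j p IHp|e {}j p IHp] //= pa jl.
- have [|q qa] := IHp _ jl; first by move=> x xp; apply: pa; right.
  by exists (Forward q) => x /= [<-|/qa//]; apply: pa; left.
- have [|q qa] := IHp _ jl; first by move=> x xp; apply: pa; right.
  by exists (Backward q) => x /= [<-|/qa//]; apply: pa; left.
Qed.

Lemma fwalk_start i j (p : fwalk i j) : List.In i (fwalk_vertices p).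
Proof. by case: p => *; left. Qed.

Lemma linked_sym a i j : linked a i j -> linked a j i.
Proof.
move=> [p]; elim: p => [{}i|e {}j p IHp|e {}j p IHp] /= pa.
- by exists (Stay i).
- have pa' x : List.In x (fwalk_vertices p) -> a x by move=> xp; apply: pa; right.
  apply: linked_trans (IHp pa') _; exists (Backward (Stay (src e))).
  move=> x /= [<-|[<-|//]]; first exact/pa'/fwalk_start.
  by apply: pa; left.
- have pa' x : List.In x (fwalk_vertices p) -> a x by move=> xp; apply: pa; right.
  apply: linked_trans (IHp pa') _; exists (Forward (Stay (tgt e))).
  move=> x /= [<-|[<-|//]]; first exact/pa'/fwalk_start.
  by apply: pa; left.
Qed.

(** The walks run from the descendant [j] back to [i], the direction in which
    subspaces are transported to [V i]. *)
Definition descendants i : set (vertex Q) :=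
  fun j => exists p : fwalk j i, against_arrows p.

Lemma descendants_refl i : descendants i i.
Proof. by exists (Stay i). Qed.

Lemma descendants_tgt i e : descendants i (src e) -> descendants i (tgt e).
Proof. by move=> [p pag]; exists (Backward p). Qed.

Lemma descendants_linked i j :
  descendants i j -> linked (descendants i) j i.
Proof.
move=> [p pag]; exists p => x /fwalk_suffix[q [_ _ qag]].
by exists q; exact: qag.
Qed.

Lemma connected_descendants i : connected (descendants i).
Proof.
split; first by exists i; exact: descendants_refl.
move=> j l ij il; apply: linked_trans (descendants_linked ij) _.
exact/linked_sym/descendants_linked.
Qed.

Lemma boundary_descendants i e :
  boundary_arrow (descendants i) e -> descendants i (tgt e).
Proof. by case=> [[/descendants_tgt]|[]]. Qed.

Lemma oba_descendants i e : tree Q -> ~ oba (descendants i) e.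
Proof.
move=> hT [/boundary_descendants te a_behind].
exact: tgt_not_behind (a_behind _ te).
Qed.

(** The lengths of the walks from [i] into [a] have a minimum, attained at a
    closest vertex. *)
Lemma closest_exists a i j : a j -> linked setT i j ->
  exists l, closest a i l.
Proof.
move=> aj [p _].
pose P n := `[< exists l (q : fwalk i l), a l /\ fwalk_length q = n >].
have exP : exists n, P n.
  by exists (fwalk_length p); apply/asboolP; exists j, p.
case: (ex_minnP exP) => n /asboolP[l [q [al qn]]] n_min.
exists l; split=> //; exists q => l' q' al'.
by rewrite qn; apply: n_min; apply/asboolP; exists l', q'.
Qed.

End Walks.

Section Transport.
Variables (k : fieldType) (Q : quiver) (V : representation k Q).

Lemma transport_along_against (i j : vertex Q) (p : fwalk i j) :
  against_arrows p -> transport_along (V := V) p setT = setT.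
Proof. by elim: p => //= e {}j p IHp pag; rewrite preimage_setT IHp. Qed.

Lemma transport_descendant (i j : vertex Q) (v : V i) :
  descendants i j -> @transport k Q V j i setT v.
Proof.
move=> [p pag]; have [q [qinj _ qag]] := loop_erasure p.
by exists q; split=> //; rewrite transport_along_against //; exact: qag.
Qed.

Lemma Fsub_descendants (i : vertex Q) (v : V i) :
  tree Q -> Fsub (V := V) (descendants i) v.
Proof.
move=> hT; split=> [e [/boundary_descendants te _]|e /(oba_descendants hT)//|E].
- rewrite /Vplus; case: ifP => // _; exact: transport_descendant.
- move=> [[[n [En _]] _ _ _] sub]; rewrite /Vvirtual; case: ifP => // _.
  have Ej : walk_vertices E (wpos E n) by exists n.
  have ij : linked setT i (wpos E n).
    by case: hT => _ _ [_ conn] _; exact: conn.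
  have [l il] := closest_exists Ej ij.
  by exists l; split=> //; apply: transport_descendant; apply: sub; case: il.
Qed.

End Transport.

Theorem proposition5p3 (k : fieldType) (Q : quiver) (V : representation k Q)
    (hT : tree Q) (hB : finitely_branched Q) (hO : eventually_outward Q) :
  forall i : vertex Q,
    sum_of_subspaces (@connected Q) (fun a : set (vertex Q) => @Fsub k Q V a i) =
    [set: V i]%classic.
Proof.
move=> i; apply/seteqP; split=> // v _.
exists 1, (fun=> descendants i), (fun=> v); split; last by rewrite big_ord1.
by move=> _; split; [exact: connected_descendants | exact: Fsub_descendants].
Qed.
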